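(* Let $(a_n)$ be an arithmetic sequence with ratios $(b_n)$ such that for each integer $m\ge 1$, $$\lim_{n\to\infty}\frac{\sum_{i=0}^{m-1}(b_{n-i}-1)}{\sum_{i=1}^{n}(b_i-1)}=0.$$ Let $(d_n)$ be the non-arithmetic sequence associated with $(a_n)$. Then $|t^s_{(d_n)}(\mathbb{T})|=\mathfrak{c}$.
   Context: $\mathbb{T}=\mathbb{R}/\mathbb{Z}$ is the circle group; for real $x$, $\|x\|$ denotes the distance from $x$ to the nearest integer (this is well defined on $\mathbb{T}$). $\mathfrak{c}$ is the cardinality of the continuum. Arithmetic sequence: a sequence of positive integers $(a_n)_{n\ge 0}$ with $1=a_0<a_1<a_2<\cdots$ and $a_n\mid a_{n+1}$ for every $n$. Its ratios are $b_n=a_n/a_{n-1}$ for $n\ge 1$ (integers $\ge 2$). (In the limit above, $n\ge m$.) Associated sequence: $(d_n)_{n\ge 1}$ is the increasing enumeration of the set $\{r a_k : k\ge 0,\ 1\le r<b_{k+1}\}$. Density: for $A\subseteq\mathbb{N}$, $\overline{d}(A)=\limsup_{n\to\infty}\frac{|A\cap[0,n-1]|}{n}$ and $\underline{d}(A)=\liminf_{n\to\infty}\frac{|A\cap[0,n-1]|}{n}$; if they are equal the common value is the natural density $d(A)$. For a sequence of integers $(u_n)$, the statistically characterized subgroup is $t^s_{(u_n)}(\mathbb{T})=\{x\in\mathbb{T}: u_nx\to 0 \text{ statistically}\}$, where $u_nx\to0$ statistically means that for every $\varepsilon>0$ the set $\{n:\|u_nx\|\ge\varepsilon\}$ has natural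 density $0$. *)

(* Defs.v *)
From HB Require Import structures.
From mathcomp Require Import all_boot all_order all_algebra.
From mathcomp Require Import generic_quotient ring_quotient.
From mathcomp Require Import all_classical all_reals all_analysis.

Set Implicit Arguments.
Unset Strict Implicit.
Unset Printing Implicit Defensive.

Import Order.TTheory GRing.Theory Num.Theory.
Import numFieldNormedType.Exports.

Local Open Scope classical_set_scope.
Local Open Scope ring_scope.
Local Open Scope quotient_scope.

Definition arithmetic_seq (a : nat -> nat) : Prop :=
  a 0%N = 1%N /\ forall n, (a n < a n.+1)%N /\ (a n %| a n.+1)%N.

(* Only meaningful for n >= 1. *)
Definition seq_ratio (a : nat -> nat) (n : nat) : nat := (a n %/ a n.-1)%N.

(* The enumeration starts at index 1; the value d 0 is unconstrained. *)
Definition associated_seq (a d : nat -> nat) : Prop :=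
  (forall m n, (1 <= m)%N -> (m < n)%N -> (d m < d n)%N) /\
  d @` [set n | (1 <= n)%N] =
  [set j | exists k r,
    [/\ (1 <= r)%N, (r < seq_ratio a k.+1)%N & j = (r * a k)%N]].

(* R modulo its subgroup of integers, with the quotient group structure. *)
Definition circle (R : realType) : zmodType :=
  {ideal_quot (GRing.ZmodClosed.clone R (@Num.int_num_subdef R) _)}.

Definition dist_int (R : realType) (x : R) : R :=
  inf [set `|x - k%:~R| | k in [set: int]].

Definition circle_norm (R : realType) (x : circle R) : R := dist_int (repr x).

Lemma dist_intDz (R : realType) (x : R) (k : int) :
  dist_int (x + k%:~R) = dist_int x.
Proof.
congr inf; apply/seteqP; split=> y [j _ <-].
  by exists (j - k) => //; rewrite intrB opprB addrA addrAC.
by exists (j + k) => //; rewrite intrD opprD addrACA subrr addr0.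
Qed.

Lemma circle_norm_pi (R : realType) (x : R) :
  circle_norm (\pi_(circle R) x) = dist_int x.
Proof.
rewrite /circle_norm.
have /eqP := reprK (\pi_(circle R) x).
rewrite -Quotient.idealrBE => /intrP[k kE].
by rewrite -(dist_intDz x k) -kE addrC subrK.
Qed.

Section density.
Variable R : realType.

Definition prop_below (A : set nat) (n : nat) : R :=
  (\sum_(k < n) `[< A k >])%N%:R / n%:R.

Definition upper_density (A : set nat) : R := limn_sup (prop_below A).

Definition lower_density (A : set nat) : R := limn_inf (prop_below A).

Definition has_density (A : set nat) (l : R) : Prop :=
  lower_density A = l /\ upper_density A = l.

End density.

(* Sequences are indexed by n >= 1, so index 0 is left out. *)
Definition stat_null (R : realType) (u : nat -> int) (x : circle R) : Prop :=
  forall e : R, 0 < e ->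
    has_density [set n | (1 <= n)%N /\ e <= circle_norm (x *~ u n)] (0 : R).

Definition stat_char_subgroup (R : realType) (u : nat -> int) :
  set (circle R) := [set x | stat_null u x].

(* Main.v *)
Require Import Defs.
From mathcomp Require Import all_boot all_order all_algebra.
From mathcomp Require Import ring_quotient zify lra.
From mathcomp Require Import all_classical all_reals all_analysis.

Import Order.TTheory GRing.Theory Num.Theory.
Import numFieldNormedType.Exports.

Local Open Scope classical_set_scope.
Local Open Scope card_scope.
Local Open Scope ring_scope.

(** Write [k p] for the index [sparse_index a p], and [x_B] for the sum of the
    [1 / a (k p)] over the [p] in a set [B] of naturals. The terms [a (k p)] grow
    by factors of at least 4, so [x_B] determines [B], even modulo 1
    ([lacunary_sum_inj], [circle_pi_inj]); this gives continuum many points of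
    the circle, one for each real [r] through its cut [rational_cut r]. The
    converse bound is clear, since a point of the circle has a real
    representative.

    Every [x_B] lies in the subgroup. The associated sequence comes in blocks:
    the indices [n] with [a i <= d n < a j] are those with
    [block_end a i < n <= block_end a j], and then [a i] divides [d n]
    ([enum_between]). Take [d n] between [a (k p)] and [a (k p.+1 - m)]. It
    clears the denominators of the terms of [x_B] up to index [p], while the
    tail of [x_B] is of order [1 / a (k p.+1)], and
    [2 ^ m * a (k p.+1 - m) <= a (k p.+1)]. Hence the distance from [d n * x_B]
    to the integers is at most [4/3 / 2 ^ m] ([dist_int_lacunary_sum]). For fixed
    [e > 0] and a suitable [m], the bad indices are therefore confined to the
    initial indices up to [block_end a (k 0)] and to the windows of [m] blocks
    just before the [k p].

    It remains to see that these windows have density 0 ([sparse_density]). The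
    hypothesis on the ratios says exactly that the window before [k] has length
    [o(block_end a k)] ([block_windows_negligible]), so the last window that starts
    below [n], say the one before [k p.+1], is negligible with respect to [n];
    all earlier ones lie below [block_end a (k p)], which is negligible by the
    choice of the sequence [k]. *)

(** * Arithmetic sequences and their blocks *)

(** Block [k] of the associated sequence consists of the multiples [r * a k]
    with [1 <= r < b_(k+1)], so it has [b_(k+1) - 1] terms; [block_end a k] is
    the number of terms in the blocks before it, i.e. the last index [n >= 1]
    with [d n < a k]. It is also the denominator in the hypothesis on the
    ratios. *)
Definition block_end (a : nat -> nat) (k : nat) : nat :=
  (\sum_(1 <= i < k.+1) (seq_ratio a i).-1)%N.

Lemma block_endS a k : block_end a k.+1 = (block_end a k + (seq_ratio a k.+1).-1)%N.
Proof. by rewrite /block_end big_nat_recr. Qed.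

Lemma block_end0 a : block_end a 0 = 0%N.
Proof. by rewrite /block_end big_geq. Qed.

Section Arithmetic.
Variables (a : nat -> nat) (ha : arithmetic_seq a).

Lemma arith_gt0 n : (0 < a n)%N.
Proof.
case: ha => a0 aS; elim: n => [|n IH]; first by rewrite a0.
by have [] := aS n; lia.
Qed.

Lemma arith_ratioE n : a n.+1 = (seq_ratio a n.+1 * a n)%N.
Proof. by case: ha => _ aS; have [_ dv] := aS n; rewrite /seq_ratio divnK. Qed.

Lemma arith_ratio_gt1 n : (1 < seq_ratio a n.+1)%N.
Proof.
case: ha => _ /(_ n)[lt _]; move: lt (arith_gt0 n); rewrite arith_ratioE; nia.
Qed.

Lemma arith_ratio0 : seq_ratio a 0 = 1%N.
Proof. by rewrite /seq_ratio divnn arith_gt0. Qed.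

Lemma arith_ratio_gt0 n : (0 < seq_ratio a n)%N.
Proof. by case: n => [|n]; [rewrite arith_ratio0 | have := arith_ratio_gt1 n; lia]. Qed.

Lemma arith_dvd i j : (i <= j)%N -> (a i %| a j)%N.
Proof.
elim: j => [|j IH]; first by rewrite leqn0 => /eqP ->.
rewrite leq_eqVlt => /orP[/eqP -> //|]; rewrite ltnS => /IH dv.
by rewrite arith_ratioE dvdn_mull.
Qed.

Lemma arith_le i j : (i <= j)%N -> (a i <= a j)%N.
Proof. by move=> /arith_dvd /dvdn_leq; apply; apply: arith_gt0. Qed.

Lemma arith_growth i j : (2 ^ i * a j <= a (j + i))%N.
Proof.
elim: i => [|i IH]; first by rewrite addn0 mul1n.
rewrite addnS arith_ratioE expnS; have := arith_ratio_gt1 (j + i); nia.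
Qed.

Lemma block_end_mono i j : (i <= j)%N -> (block_end a i <= block_end a j)%N.
Proof.
elim: j => [|j IH]; first by rewrite leqn0 => /eqP ->.
by rewrite leq_eqVlt => /orP[/eqP -> //|/IH]; rewrite block_endS; lia.
Qed.

Lemma block_end_ge k : (k <= block_end a k)%N.
Proof.
elim: k => [//|k IH]; rewrite block_endS.
by have := arith_ratio_gt1 k; lia.
Qed.

(** The numerator in the hypothesis counts the terms in the [m] blocks that
    precede [a k]. Truncated subtraction is harmless: once [k - i] reaches [0]
    the ratio is [a 0 %/ a 0 = 1], which contributes nothing. *)
Lemma window_length k m :
  (block_end a k - block_end a (k - m) =
   \sum_(0 <= i < m) (seq_ratio a (k - i)).-1)%N.
Proof.
elim: m => [|m IH]; first by rewrite big_geq // subn0 subnn.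
rewrite big_nat_recr //= -IH.
have mon : (block_end a (k - m) <= block_end a k)%N.
  by apply: block_end_mono; lia.
case E : (k - m)%N mon => [|j] mon.
  have -> : (k - m.+1 = 0)%N by lia.
  by rewrite arith_ratio0 addn0.
have -> : (k - m.+1 = j)%N by lia.
by move: mon; rewrite block_endS; lia.
Qed.

(** * Locating the terms of the associated sequence *)

Section Enumeration.
Variables (d : nat -> nat) (hd : associated_seq a d).

Lemma enum_mem k r : (1 <= r)%N -> (r < seq_ratio a k.+1)%N ->
  exists2 n, (1 <= n)%N & d n = (r * a k)%N.
Proof.
move=> r1 rb; have [_ img] := hd.
have : [set j | exists k r, [/\ (1 <= r)%N, (r < seq_ratio a k.+1)%N
    & j = (r * a k)%N]] (r * a k)%N by exists k, r.
by rewrite -img => -[n /= n1 dn]; exists n.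
Qed.

Lemma enum_form n : (1 <= n)%N ->
  exists k r, [/\ (1 <= r)%N, (r < seq_ratio a k.+1)%N & d n = (r * a k)%N].
Proof.
move=> n1; have [_ img] := hd.
have : (d @` [set n | (1 <= n)%N]) (d n) by exists n.
by rewrite img.
Qed.

Lemma enum_lt_inv m n : (1 <= n)%N -> (d m < d n)%N -> (m < n)%N.
Proof.
move=> n1 lt; rewrite ltnNge; apply/negP => nm; have [inc _] := hd.
move: nm; rewrite leq_eqVlt => /orP[/eqP E|/(inc _ _ n1)]; last lia.
by move: lt; rewrite E ltnn.
Qed.

Lemma enum_le m n : (1 <= m)%N -> (m <= n)%N -> (d m <= d n)%N.
Proof.
have [inc _] := hd; move=> m1; rewrite leq_eqVlt => /orP[/eqP -> //|].
by move=> /(inc _ _ m1) /ltnW.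
Qed.

(** Terms from block [k] on are multiples of [a k], and the terms of the blocks
    before it are below [a k]; so none lies strictly between two consecutive
    positive multiples of [a k]. *)
Lemma enum_gap n k r : (1 <= n)%N -> (1 <= r)%N -> (r * a k < d n)%N ->
  (r.+1 * a k <= d n)%N.
Proof.
move=> n1 r1; have [j [s [s1 sb ->]]] := enum_form n n1 => lt.
have [kj|jk] := leqP k j.
  move: lt; have /dvdnP[q ->] := arith_dvd k j kj.
  by rewrite mulnA ltn_pmul2r ?arith_gt0 // leq_pmul2r ?arith_gt0.
have := arith_le j.+1 k jk; rewrite arith_ratioE.
by have := arith_gt0 j; nia.
Qed.

Lemma enum_succ n k r :  (1 <= n)%N -> (1 <= r)%N -> d n = (r * a k)%N ->
  (exists2 l, (1 <= l)%N & d l = (r.+1 * a k)%N) -> d n.+1 = (r.+1 * a k)%N.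
Proof.
move=> n1 r1 dn [l l1 dl]; have [inc _] := hd.
have nl : (n < l)%N.
  by apply: enum_lt_inv => //; rewrite dn dl ltn_pmul2r ?arith_gt0.
apply/eqP; rewrite eqn_leq -{1}dl enum_le //=.
by apply: enum_gap => //; rewrite -dn inc.
Qed.

Lemma enum_block k r : d (block_end a k).+1 = a k ->
  (1 <= r <= seq_ratio a k.+1)%N -> d (block_end a k + r) = (r * a k)%N.
Proof.
move=> first; elim: r => [//|[_ _|r IH rb]]; first by rewrite addn1 mul1n.
rewrite addnS; apply: enum_succ => //; [lia|by apply: IH; lia|].
have [lt|ge] := ltnP r.+2 (seq_ratio a k.+1); first exact: enum_mem.
(* The multiple with coefficient b_(k+1) is a_(k+1), which opens block k+1. *)
have -> : r.+2 = seq_ratio a k.+1 by lia.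
rewrite -arith_ratioE -(mul1n (a _)); apply: enum_mem => //.
exact: arith_ratio_gt1.
Qed.

Lemma enum_first k : d (block_end a k).+1 = a k.
Proof.
elim: k => [|k IH]; last first.
  rewrite block_endS -addnS prednK ?arith_ratio_gt0 //.
  by rewrite enum_block ?arith_ratio_gt0 /= ?arith_ratioE.
rewrite block_end0; have [a0 _] := ha.
have [l l1 dl] := enum_mem 0 1 (leqnn _) (arith_ratio_gt1 0).
rewrite mul1n in dl; apply/eqP; rewrite eqn_leq -{1}dl enum_le //= a0.
by have [j [s [s1 _ ->]]] := enum_form 1 isT; rewrite muln_gt0 s1 arith_gt0.
Qed.

(** A term whose index exceeds [block_end a i] lies in a block [k >= i], hence is
    a multiple of [a k] and so of [a i]. *)
Lemma enum_between i j n : (block_end a i < n <= block_end a j)%N ->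
  (a i %| d n)%N /\ (d n < a j)%N.
Proof.
move=> /andP[lo hi]; have n1 : (1 <= n)%N by lia.
have [inc _] := hd.
split; last by rewrite -enum_first; apply: inc.
have := enum_le (block_end a i).+1 n isT lo; rewrite enum_first.
have [k [r [r1 rb ->]]] := enum_form n n1 => le.
apply: dvdn_mull; apply: arith_dvd; rewrite leqNgt; apply/negP => ki.
have := arith_le k.+1 i ki; rewrite arith_ratioE.
by have := arith_gt0 k; nia.
Qed.

End Enumeration.
End Arithmetic.

(** * Densities *)

(** Quantifying over [t] replaces the limit 0 of a quotient of reals, so that the
    counting argument stays in [nat]. *)
Lemma block_windows_negligible {R : realType} {a : nat -> nat} (ha : arithmetic_seq a)
  (hb : forall m : nat, (1 <= m)%N ->
    (fun n : nat =>
       (\sum_(0 <= i < m) ((seq_ratio a (n - i)%N)%:R - 1 : R)) /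
       (\sum_(1 <= i < n.+1) ((seq_ratio a i)%:R - 1 : R))) @ \oo --> (0 : R)) m t :
  (1 <= m)%N -> exists N, forall n, (N <= n)%N ->
    (t * (block_end a n - block_end a (n - m)) <= block_end a n)%N.
Proof.
move=> /hb /cvgrPdist_le /(_ t.+1%:R^-1); rewrite invr_gt0 ltr0n => /(_ isT).
case=> N _ HN; exists N.+1 => n Nn; have /= := HN n (ltnW Nn).
have predE j : (seq_ratio a j)%:R - 1 = (seq_ratio a j).-1%:R :> R.
  by rewrite -[in LHS](prednK (arith_ratio_gt0 a ha j)) -natr1 addrK.
under eq_bigr do rewrite predE.
under [X in _ / X]eq_bigr do rewrite predE.
rewrite -!natr_sum -window_length // -/(block_end a n).
have Sn : (0 < block_end a n)%N by have := block_end_ge a ha n; lia.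
rewrite sub0r normrN ger0_norm ?divr_ge0 // ler_pdivrMr ?ltr0n //.
by rewrite mulrC ler_pdivlMr ?ltr0n // -natrM ler_nat mulnC; lia.
Qed.

Lemma count_interval u v N : (\sum_(k < N) (u < k <= v) <= v - u)%N.
Proof.
suff : (\sum_(k < N) (u < k <= v) <= minn N.-1 v - u)%N by lia.
elim: N => [|N IH]; first by rewrite big_ord0.
rewrite big_ord_recr /=; move: (\sum_(k < N) _)%N IH => C IH.
by case: (boolP (u < N <= v)%N) => /=; lia.
Qed.

Lemma density0_of_count {R : realType} (A : set nat) :
  (forall t, exists N, forall n, (N <= n)%N ->
     (t * \sum_(k < n) `[< A k >] <= n)%N) -> has_density A (0 : R).
Proof.
move=> small; have /cvg_limn_inf_sup[inf0 sup0] : prop_below R A @ \oo --> (0 : R).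
  apply/cvgrPdist_le => e e0.
  have [N HN] := small (Num.truncn e^-1).+1; exists N.+1 => //= n /= Nn.
  have := HN n (ltnW Nn); rewrite -(ler_nat R) natrM => le.
  have n0 : 0 < n%:R :> R by rewrite ltr0n; lia.
  rewrite sub0r normrN ger0_norm ?divr_ge0 // /prop_below ler_pdivrMr //.
  have := truncnS_gt e^-1; set t := _.+1%:R in le * => lt.
  rewrite -ler_pdivrMl //; apply: le_trans le; apply: ler_wpM2r => //; exact: ltW.
by split.
Qed.

(** The term [q.+1 * block_end a _] makes the blocks before one index a
    vanishing fraction of those before the next one, because
    [block_end a k >= k]; the gaps of at least 2 make the terms [a _] at these
    indices grow by factors of at least 4. *)
Definition sparse_index (a : nat -> nat) :=
  fix idx p := if p is q.+1 then (idx q + 2 + q.+1 * block_end a (idx q))%N else 2%N.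

Lemma sparse_index_ge a p : (p <= sparse_index a p)%N.
Proof. by elim: p => //= p IH; lia. Qed.

Lemma sparse_index_mono a i j :
  (i <= j)%N -> (sparse_index a i <= sparse_index a j)%N.
Proof.
elim: j => [|j IH]; first by rewrite leqn0 => /eqP ->.
by rewrite leq_eqVlt => /orP[/eqP -> //|/IH le] /=; lia.
Qed.

(** If [A] avoids every index range running from [block_end a (k p)] to the
    window of [m] blocks before [a (k p.+1)], then below any [n] past the start of
    that window and not past the start of the next one, [A] has at most
    [block_end a (k p) + (window length)] elements. The first summand is
    negligible by the sparsity of [k], the second by hypothesis. *)
Lemma sparse_density {R : realType} {a : nat -> nat} (ha : arithmetic_seq a)
    (k := sparse_index a) (A : set nat) m :
  (forall t, exists N, forall n, (N <= n)%N ->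
    (t * (block_end a n - block_end a (n - m)) <= block_end a n)%N) ->
  (forall n, A n -> (1 <= n)%N) ->
  (forall p n, (block_end a (k p) < n <= block_end a (k p.+1 - m))%N -> ~ A n) ->
  has_density A (0 : R).
Proof.
move=> small A1 gap; apply: density0_of_count => t.
have [N0 HN0] := small (2 * t.+1)%N.
pose p0 := maxn N0 (2 * t.+1); exists (block_end a (k p0)).+1 => n Hn.
have ex : exists q, (n <= block_end a (k q - m))%N.
  exists (n + m)%N; apply: leq_trans (block_end_ge a ha _).
  by have := sparse_index_ge a (n + m); rewrite -/k; lia.
(* Minimality of q puts n past the start of the window before k q.-1, but not
   past the start of the one before k q. *)
case: (ex_minnP ex) => q nq qmin.
have p0q : (p0 < q)%N.
  rewrite ltnNge; apply/negP => /(sparse_index_mono a) qp0.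
  have : (k q - m <= k p0)%N by exact: leq_trans (leq_subr _ _) qp0.
  by move/(block_end_mono a); lia.
case: q nq qmin p0q => [//|[|p]] nq qmin p0q.
  by move: p0q; rewrite /p0; lia.
have nlow : (block_end a (k p.+1 - m) < n)%N.
  by rewrite ltnNge; apply/negP => /qmin; rewrite ltnn.
have Wsmall : (2 * t.+1 * (block_end a (k p.+1) - block_end a (k p.+1 - m)) <=
    block_end a (k p.+1))%N.
  by apply: HN0; have := sparse_index_ge a p.+1; rewrite -/k; move: p0q; rewrite /p0; lia.
have Ssmall : (2 * t.+1 * block_end a (k p) <= block_end a (k p.+1))%N.
  apply: leq_trans (block_end_ge a ha _).
  have : (2 * t.+1 <= p.+1)%N by move: p0q; rewrite /p0; lia.
  by rewrite /k /= -/k; nia.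
(* Below n, A meets only the blocks before k p and the window before k p.+1. *)
have count : (\sum_(i < n) `[< A i >] <= block_end a (k p) +
    (block_end a (k p.+1) - block_end a (k p.+1 - m)))%N.
  apply: (@leq_trans (\sum_(i < n) ((0 < i <= block_end a (k p)) +
      (block_end a (k p.+1 - m) < i <= block_end a (k p.+1)))%N)).
    apply: leq_sum => i _; case: asboolP => //= Ai.
    have i1 := A1 _ Ai.
    case: (leqP i (block_end a (k p))) => [|lt1]; first by lia.
    case: (leqP i (block_end a (k p.+1 - m))) => [le2|lt2].
      by case: (gap p i _ Ai); rewrite lt1.
    case: (leqP i (block_end a (k p.+1))) => [|lt3]; first by lia.
    by case: (gap p.+1 i _ Ai); rewrite lt3 (leq_trans (ltnW (ltn_ord i)) nq).
  rewrite big_split; apply: leq_add; last exact: count_interval.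
  by have := count_interval 0 (block_end a (k p)) n; rewrite subn0.
have mono : (block_end a (k p.+1 - m) <= block_end a (k p.+1))%N.
  by apply: block_end_mono => //; lia.
move: Wsmall Ssmall count; move: (\sum_(i < n) _)%N => C.
move: (block_end a (k p.+1)) (block_end a (k p.+1 - m)) (block_end a (k p)) mono nlow.
by move=> S1 S2 S0 *; nia.
Qed.


(** * Lacunary sums *)

Section LacunarySums.
Variables (R : realType) (c : nat -> nat).
Hypotheses (c0 : (4 <= c 0)%N) (cS : forall p, (4 * c p <= c p.+1)%N).

Definition psum (B : nat -> bool) (p : nat) : R := \sum_(i < p) (B i)%:R / (c i)%:R.

Definition lacunary_sum (B : nat -> bool) : R := limn (psum B).

Lemma lacunary_gt0 p : 0 < (c p)%:R :> R.
Proof. by rewrite ltr0n; elim: p => [|p IH]; [|have := cS p]; lia. Qed.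

Lemma lacunaryV p : 4 * (c p.+1)%:R^-1 <= (c p)%:R^-1 :> R.
Proof.
rewrite ler_pdivrMr ?lacunary_gt0 // mulrC ler_pdivlMr ?lacunary_gt0 //.
by rewrite -natrM ler_nat.
Qed.

Lemma psumS B p : psum B p.+1 = psum B p + (B p)%:R / (c p)%:R.
Proof. by rewrite /psum big_ord_recr. Qed.

Lemma psum_le B p q : (p <= q)%N -> psum B p <= psum B q.
Proof.
elim: q => [|q IH]; first by rewrite leqn0 => /eqP ->.
rewrite leq_eqVlt => /orP[/eqP -> //|/IH le]; apply: le_trans le _.
by rewrite psumS lerDl divr_ge0.
Qed.

(** Since [c i.+1 >= 4 * c i], each term satisfies
    [1 / c i <= 4/3 * (1 / c i - 1 / c i.+1)], so the tail telescopes. *)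
Lemma psum_tail B p q : (p <= q)%N ->
  psum B q <= psum B p + 4 / 3 * (c p)%:R^-1 - 4 / 3 * (c q)%:R^-1.
Proof.
elim: q => [|q IH]; first by rewrite leqn0 => /eqP ->; lra.
rewrite leq_eqVlt => /orP[/eqP ->|/IH le]; first by lra.
have : psum B q.+1 <= psum B q + (c q)%:R^-1.
  by rewrite psumS lerD2l; case: (B q); rewrite ?mul1r // mul0r invr_ge0.
have := lacunaryV q; lra.
Qed.

Lemma psum_upper B p q : psum B q <= psum B p + 4 / 3 * (c p)%:R^-1.
Proof.
have cV j : 0 < (c j)%:R^-1 :> R by rewrite invr_gt0 lacunary_gt0.
have [pq|/ltnW qp] := leqP p q.
  by have := psum_tail B p q pq; have := cV q; lra.
by have := psum_le B q p qp; have := cV p; lra.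
Qed.

Lemma psum_cvg B : cvgn (psum B).
Proof.
apply: nondecreasing_is_cvgn; first by move=> p q; apply: psum_le.
by exists (psum B 0 + 4 / 3 * (c 0)%:R^-1) => _ [q _ <-]; apply: psum_upper.
Qed.

Lemma lacunary_sum_ge B p : psum B p <= lacunary_sum B.
Proof.
by apply: nondecreasing_cvgn_le; [move=> ? ?; apply: psum_le|apply: psum_cvg].
Qed.

Lemma lacunary_sum_le B p : lacunary_sum B <= psum B p + 4 / 3 * (c p)%:R^-1.
Proof.
by apply: limr_le; [apply: psum_cvg|near=> q; apply: psum_upper].
Unshelve. all: by end_near.
Qed.

Lemma lacunary_sum_itv B : 0 <= lacunary_sum B < 1.
Proof.
have := lacunary_sum_ge B 0; have := lacunary_sum_le B 0.
rewrite /psum big_ord0.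
have : (c 0)%:R^-1 <= 4^-1 :> R.
  by rewrite lef_pV2 ?posrE ?ltr0n ?ler_nat // -(ltr_nat R) lacunary_gt0.
lra.
Qed.

(** Digit [p] contributes [1 / c p], more than the at most
    [4/3 / c p.+1 <= 1/3 / c p] that all later digits contribute together: such
    sums are ordered lexicographically. *)
Lemma lacunary_sum_lt B B' p : (forall i, (i < p)%N -> B i = B' i) ->
  ~~ B p -> B' p -> lacunary_sum B < lacunary_sum B'.
Proof.
move=> eqB /negbTE Bp B'p.
have := lacunary_sum_le B p.+1; have := lacunary_sum_ge B' p.+1.
have := lacunaryV p; have cV : 0 < (c p)%:R^-1 :> R by rewrite invr_gt0 lacunary_gt0.
have -> : psum B p.+1 = psum B' p.+1 - (c p)%:R^-1.
  rewrite !psumS Bp B'p mul0r mul1r addrK addr0.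
  by apply: eq_bigr => i _; rewrite eqB.
lra.
Qed.

Lemma lacunary_sum_inj B B' : lacunary_sum B = lacunary_sum B' -> B =1 B'.
Proof.
move=> eqx i; apply/eqP; apply: contraT => neq.
have [p Np pmin] := ex_minnP (ex_intro (fun j => B j != B' j) i neq).
have eqB j : (j < p)%N -> B j = B' j.
  move=> jp; apply/eqP; apply: contraT => /pmin; lia.
case Bp : (B p) Np; case B'p : (B' p) => // _.
- have := lacunary_sum_lt B' B p (fun j jp => esym (eqB j jp)).
  by rewrite Bp B'p eqx ltxx => /(_ isT isT).
- have := lacunary_sum_lt B B' p eqB.
  by rewrite Bp B'p eqx ltxx => /(_ isT isT).
Qed.

Lemma dist_int_le (y : R) (z : int) : dist_int y <= `|y - z%:~R|.
Proof. by apply: ge_inf; [exists 0 => _ [k _ <-]|exists z]. Qed.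

(** Multiplication by [D] turns the first [p] terms into integers, so only [D]
    times the tail, itself at most [4/3 / c p], is left. *)
Lemma dist_int_lacunary_sum B p D : (forall i, (i < p)%N -> (c i %| D)%N) ->
  dist_int (lacunary_sum B * D%:R) <= 4 / 3 * D%:R / (c p)%:R.
Proof.
move=> dvd.
have psumE : psum B p * D%:R = (\sum_(i < p) B i * (D %/ c i))%N%:R.
  rewrite /psum mulr_suml natr_sum; apply: eq_bigr => i _.
  rewrite natrM -mulrA; congr (_ * _); have ci := lacunary_gt0 i.
  by rewrite -{1}(divnK (dvd i (ltn_ord i))) natrM mulrC mulfK // gt_eqF.
have := dist_int_le (lacunary_sum B * D%:R) (Posz (\sum_(i < p) B i * (D %/ c i))%N).
rewrite -pmulrn -psumE -mulrBl => le; apply: le_trans le _.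
rewrite ger0_norm ?mulr_ge0 ?subr_ge0 ?lacunary_sum_ge //.
rewrite mulrAC ler_wpM2r // lerBlDl; exact: lacunary_sum_le.
Qed.

End LacunarySums.

(** * Points of the subgroup *)

Lemma circle_pi_inj {R : realType} {x y : R} : 0 <= x < 1 -> 0 <= y < 1 ->
  (\pi_(circle R) x = \pi_(circle R) y)%qT -> x = y.
Proof.
move=> x01 y01 /eqP; rewrite -Quotient.idealrBE => /intrP[k kE].
have : (-1)%:~R < k%:~R :> R by rewrite -kE; lra.
have : k%:~R < 1%:~R :> R by rewrite -kE; lra.
rewrite !ltr_int => k1 k0; have k00 : k = 0 by lia.
by apply/eqP; rewrite -subr_eq0 kE k00.
Qed.

Lemma circle_norm_piMz {R : realType} (x : R) (n : nat) :
  circle_norm (\pi_(circle R)%qT x *~ n%:Z) = dist_int (x * n%:R).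
Proof.
by rewrite -(raddfMz \pi_(circle R)%qT) circle_norm_pi -pmulrn mulr_natr.
Qed.

Lemma sparse_terms0 {a : nat -> nat} (ha : arithmetic_seq a) :
  (4 <= a (sparse_index a 0))%N.
Proof.
apply: leq_trans (arith_growth a ha 2 0).
by rewrite -[leqLHS]/(4 * 1)%N leq_mul // arith_gt0.
Qed.

Lemma sparse_termsS {a : nat -> nat} (ha : arithmetic_seq a) p :
  (4 * a (sparse_index a p) <= a (sparse_index a p.+1))%N.
Proof.
apply: leq_trans (arith_growth a ha 2 _) (arith_le a ha _ _ _).
by rewrite /= leq_addr.
Qed.

(** For [block_end a (k p) < n <= block_end a (k p.+1 - m)], the term [d n] is a
    multiple of [a (k p)], hence of every earlier denominator, and is smaller
    than [a (k p.+1 - m) <= a (k p.+1) / 2 ^ m]. So [d n] times the sum is within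
    [4/3 / 2 ^ m] of an integer, and only the indices in the windows, or up to
    [block_end a (k 0)], can be bad. *)
Lemma lacunary_sum_stat_null {R : realType} {a d : nat -> nat}
  (ha : arithmetic_seq a)
  (small : forall m t, (1 <= m)%N -> exists N, forall n, (N <= n)%N ->
    (t * (block_end a n - block_end a (n - m)) <= block_end a n)%N)
  (hd : associated_seq a d) (B : nat -> bool) :
  @stat_null R (fun n => (d n)%:Z)
    (\pi_(circle R)%qT (lacunary_sum R (a \o sparse_index a) B)).
Proof.
set k := sparse_index a.
have c0 := sparse_terms0 ha; have cS := sparse_termsS ha.
(* The constant 2 leaves room above the factor 4/3 of the tail bound. *)
move=> e e0; have [m m1 me] : exists2 m, (1 <= m)%N & 2 < e * (2 ^ m)%:R.
  exists (Num.truncn (2 / e)).+1 => //; rewrite mulrC -ltr_pdivrMr //.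
  apply: lt_trans (truncnS_gt _) _; rewrite ltr_nat; exact: ltn_expl.
apply: (sparse_density ha _ m).
- by move=> t; apply: small.
- by move=> n [].
move=> p n /andP[lo hi] [n1]; apply/negP; rewrite -ltNge circle_norm_piMz.
have [dvd lt] : (a (k p) %| d n)%N /\ (d n < a (k p.+1 - m))%N.
  by apply: (enum_between a ha d hd); rewrite lo.
have mk : (m <= k p.+1)%N.
  rewrite leqNgt; apply/negP => km; move: hi.
  by rewrite (eqP (ltnW km : k p.+1 - m == 0)%N) block_end0; lia.
apply: le_lt_trans (dist_int_lacunary_sum R _ c0 cS B p.+1 (d n) _) _.
  by move=> i ip; apply: dvdn_trans dvd; apply: arith_dvd => //; apply: sparse_index_mono.
have cp : 0 < (a (k p.+1))%:R :> R by rewrite ltr0n arith_gt0.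
rewrite ltr_pdivrMr //=.
have grow : (2 ^ m)%:R * (d n)%:R <= (a (k p.+1))%:R :> R.
  rewrite -natrM ler_nat; apply: leq_trans (leq_mul (leqnn _) (ltnW lt)) _.
  by have := arith_growth a ha m (k p.+1 - m); rewrite subnK.
have dn : 0 < (d n)%:R :> R.
  have [j [r [r1 _ ->]]] := enum_form a d hd n n1.
  by rewrite ltr0n muln_gt0 r1 arith_gt0.
have := ler_wpM2l (ltW e0) grow; rewrite mulrA => /(lt_le_trans _); apply.
apply: (@lt_trans _ _ (2 * (d n)%:R)); last by rewrite ltr_pM2r.
by rewrite ltr_pM2r //; lra.
Qed.

(** The Dedekind cut of [r], read through a numbering of the rationals: an
    injection of the reals into binary sequences. *)
Definition rational_cut {R : realType} (r : R) (n : nat) : bool :=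
  if @unpickle rat n is Some q then ratr q < r else false.

Lemma rational_cut_inj {R : realType} (r s : R) :
  rational_cut r =1 rational_cut s -> r = s.
Proof.
wlog : r s / r < s => [wl eqc|rs eqc].
  by have [/wl|/wl e|//] := ltgtP r s; [apply|apply/esym/e => n; rewrite eqc].
have [q] := rat_in_itvoo rs; rewrite in_itv /= => /andP[rq qs].
have := eqc (pickle q); rewrite /rational_cut pickleK qs => qr.
by have := lt_trans rq qr; rewrite ltxx.
Qed.

Theorem theorem3p2 (R : realType) (a d : nat -> nat)
  (ha : arithmetic_seq a)
  (hb : forall m : nat, (1 <= m)%N ->
    (fun n : nat =>
       (\sum_(0 <= i < m) ((seq_ratio a (n - i)%N)%:R - 1 : R)) /
       (\sum_(1 <= i < n.+1) ((seq_ratio a i)%:R - 1 : R))) @ \oo --> (0 : R))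
  (hd : associated_seq a d) :
  @stat_char_subgroup R (fun n => (d n)%:Z) #= [set: R].
Proof.
rewrite card_eq_le; apply/andP; split.
  apply/pcard_injP; exists (fun x : circle R => repr x) => x y _ _ E.
  by rewrite -(reprK x) E reprK.
pose f (r : R) := \pi_(circle R)%qT
  (lacunary_sum R (a \o sparse_index a) (rational_cut r)).
have finj : injective f.
  have c0 := sparse_terms0 ha; have cS := sparse_termsS ha.
  move=> r s /circle_pi_inj E; apply: rational_cut_inj.
  apply: (lacunary_sum_inj R (a \o sparse_index a) c0 cS).
  by apply: E; apply: lacunary_sum_itv.
have /card_eqPle[_ le] := inj_card_eq (A := setT) (in2W finj).
apply: card_le_trans le (subset_card_le _) => _ [r _ <-].
apply: lacunary_sum_stat_null => // m t.
exact: (block_windows_negligible ha hb).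
Qed.
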